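(* Let $A\in\mathbb C^{N\times N}$ with Jordan decomposition $A=V_AJV_A^{-1}$, let $T$ be a permutation matrix, and let $B=TAT^{-1}$ (so $\mathcal G(B)$ is isomorphic to $\mathcal G(A)$) with Jordan decomposition $B=V_BJV_B^{-1}$, $V_B=TV_A$. Let $\mathscr J_{A,ij}=\mathrm{span}\{V_{A,ij}\}$ and $\mathscr J_{B,ij}=\mathrm{span}\{V_{B,ij}\}$ be the Jordan subspaces spanned by the $j$th Jordan chain of eigenvalue $\lambda_i$. Then $$\mathrm{TV}_{\mathbf G_A^J}(\mathscr J_{A,ij})=\mathrm{TV}_{\mathbf G_B^J}(\mathscr J_{B,ij}).$$
   Context: $\mathcal G(A)$ is the (weighted, directed) graph with adjacency matrix $A\in\mathbb C^{N\times N}$. Each adjacency matrix is considered together with a chosen Jordan decomposition $A=VJV^{-1}$: $A$ has distinct eigenvalues $\lambda_1,\dots,\lambda_k$ with geometric multiplicities $g_i$; $J$ is block diagonal with upper triangular Jordan blocks of size $r_{ij}$ for $\lambda_i$ ($i=1,\dots,k$, $j=1,\dots,g_i$) in a fixed order; $V=[V_{ij}]$ is partitioned conformally, the columns of $V_{ij}\in\mathbb C^{N\times r_{ij}}$ being a Jordan chain of $\lambda_i$; $\mathrm{span}\{V_{ij}\}$ denotes column span. Jordan equivalence class: $\mathbf G_A^J$ is the set of graphs $\mathcal G(C)$ such that $C$ has a Jordan decomposition $C=XJX^{-1}$ with the same $J$ and with $\mathrm{span}\{X_{pq}\}=\mathrm{span}\{V_{pq}\}$ for all $p,q$. Total variation: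 for $C=XJX^{-1}$, $\mathrm{TV}_G(X_{ij})=\|X_{ij}-CX_{ij}\|_1$, where $\|\cdot\|_1$ is the induced $L^1$ matrix norm (maximum absolute column sum). Class total variation of $\mathscr J_{ij}=\mathrm{span}\{V_{ij}\}$: $$\mathrm{TV}_{\mathbf G_A^J}(\mathscr J_{ij})=\sup \mathrm{TV}_G(X_{ij}),$$ the supremum over all $\mathcal G(C)\in\mathbf G_A^J$ and all eigenvector matrices $X$ with $C=XJX^{-1}$, $\mathrm{span}\{X_{pq}\}=\mathrm{span}\{V_{pq}\}$ for all $p,q$, and $\|X_{ij}\|_1=1$. *)

(* Defs.v *)
From HB Require Import structures.
From mathcomp Require Import all_boot all_order all_algebra.
From mathcomp Require Import complex.
From mathcomp Require Import all_classical all_reals all_analysis.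

Set Implicit Arguments.
Unset Strict Implicit.
Unset Printing Implicit Defensive.

Import Order.TTheory GRing.Theory Num.Theory.
Local Open Scope classical_set_scope.
Local Open Scope ring_scope.

(* A weighted directed graph on the vertex set 'I_N is identified with its
   adjacency matrix.  Eigenvalues are indexed by i : 'I_k, the Jordan chains of
   the i-th one by j : 'I_(g i), and r i j is the length of chain (i, j); the
   chains are ordered lexicographically in (i, j). *)

Notation jdim r := (\sum_i \sum_j r i j)%N.

Section JordanForm.
Context {R : realType} {k : nat} {g : 'I_k -> nat}.
Context {r : forall i : 'I_k, 'I_(g i) -> nat}.
Arguments r : clear implicits.
Implicit Types (lambda : 'I_k -> R[i]) (A C V X : 'M[R[i]]_(jdim r)).

Definition jordan_block (n : nat) (a : R[i]) : 'M[R[i]]_n :=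
  \matrix_(p < n, q < n) (if p == q then a else if p.+1 == q :> nat then 1 else 0).

Definition jordan_mx lambda : 'M[R[i]]_(jdim r) :=
  \mxdiag_(i < k) \mxdiag_(j < g i) jordan_block (r i j) (lambda i).

(* Each lambda i really is an eigenvalue (g i > 0), the lambda i are pairwise
   distinct and no block is empty; hence k, g i are the number of distinct
   eigenvalues and the geometric multiplicities. *)
Definition jordan_decomposition lambda A V : Prop :=
  [/\ injective lambda,
      forall i, (0 < g i)%N,
      forall i j, (0 < r i j)%N,
      V \in unitmx &
      A = V *m jordan_mx lambda *m invmx V].

Definition jordan_cols V (i : 'I_k) (j : 'I_(g i)) : 'M[R[i]]_(jdim r, r i j) :=
  submxrow (submxrow V i) j.

Definition col_span (m n : nat) (M : 'M[R[i]]_(m, n)) : {vspace 'cV[R[i]]_m} :=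
  <<[seq col q M | q <- enum 'I_n]>>%VS.

Definition jordan_subspace V (i : 'I_k) (j : 'I_(g i)) :
    {vspace 'cV[R[i]]_(jdim r)} :=
  col_span (jordan_cols V j).

(* The class of A is the case W = jordan_subspace V for the chosen
   decomposition A = V J V^-1: it depends on A only through J and the family
   W of Jordan subspaces. *)
Definition jordan_class lambda
    (W : forall i : 'I_k, 'I_(g i) -> {vspace 'cV[R[i]]_(jdim r)}) :
    set 'M[R[i]]_(jdim r) :=
  [set C | exists X, jordan_decomposition lambda C X /\
                     forall p q, jordan_subspace X q = W p q].

(* Induced L^1 norm: maximum absolute column sum (0 if there is no column). *)
Definition mx_norm1 (m n : nat) (M : 'M[R[i]]_(m, n)) : R :=
  \big[Num.max/0]_(q < n) \sum_(p < m) ComplexField.Normc.normc (M p q).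

Definition total_variation (m n : nat) (C : 'M[R[i]]_m)
    (Y : 'M[R[i]]_(m, n)) : R :=
  mx_norm1 (Y - C *m Y).

Definition class_total_variation lambda
    (W : forall i : 'I_k, 'I_(g i) -> {vspace 'cV[R[i]]_(jdim r)})
    (i : 'I_k) (j : 'I_(g i)) : \bar R :=
  ereal_sup [set t | exists C X,
    [/\ jordan_class lambda W C,
        jordan_decomposition lambda C X,
        forall p q, jordan_subspace X q = W p q,
        mx_norm1 (jordan_cols X j) = 1 &
        t = (total_variation C (jordan_cols X j))%:E]].

End JordanForm.

(* Main.v *)
(** Relabelling the vertices by a permutation matrix [P] sends an admissible
    pair [(C, X)] for the class of [A] to the admissible pair
    [(P C P^-1, P X)] for the class of [P A P^-1].  It permutes the rows of
    [X_ij] and of [X_ij - C X_ij], hence preserves their column sums; this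
    bounds one supremum by the other, and [P^-1] gives the reverse bound. *)

Require Import Defs.
From mathcomp Require Import all_boot all_order all_fingroup all_algebra.
From mathcomp Require Import complex.
From mathcomp Require Import all_classical all_reals all_analysis.

Local Open Scope ring_scope.
Import Order.TTheory GRing.Theory.

(** The span of [P *m M] thus depends on [M] only through its span, so equal Jordan subspaces stay
    equal after relabelling. *)
Lemma col_span_mulmx (R : realType) (m n : nat) (P : 'M[R[i]]_m)
    (M : 'M[R[i]]_(m, n)) :
  col_span (P *m M) = (linfun (mulmx P : 'cV_m -> 'cV_m) @: col_span M)%VS.
Proof.
rewrite /col_span limg_span -[in RHS]map_comp; congr (<<_>>)%VS.
by apply: eq_map => q /=; rewrite lfunE /= !colE mulmxA.
Qed.

Lemma mx_norm1_perm (R : realType) (m n : nat) (s : 'S_m)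
    (M : 'M[R[i]]_(m, n)) :
  mx_norm1 (perm_mx s *m M) = mx_norm1 M.
Proof.
apply: eq_bigr => q _; rewrite [RHS](reindex_inj (@perm_inj _ s)).
by apply: eq_bigr => p _; rewrite -row_permE mxE.
Qed.

(** With [P] the permutation matrix, [P Y - (P C P^-1)(P Y) = P (Y - C Y)], whose norm is that of
    [Y - C Y]. *)
Lemma total_variation_perm (R : realType) (m n : nat) (s : 'S_m)
    (C : 'M[R[i]]_m) (Y : 'M[R[i]]_(m, n)) :
  Defs.total_variation (perm_mx s *m C *m invmx (perm_mx s))
    (perm_mx s *m Y) = Defs.total_variation C Y.
Proof.
by rewrite /Defs.total_variation -!mulmxA mulKmx ?unitmx_perm// -mulmxBr
  mx_norm1_perm.
Qed.

Section Relabelling.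
Context {R : realType} {k : nat} {g : 'I_k -> nat}.
Context {r : forall i : 'I_k, 'I_(g i) -> nat}.
Implicit Types (lambda : 'I_k -> R[i]) (P C V X : 'M[R[i]]_(jdim r)).

Lemma jordan_cols_mulmx P X (i : 'I_k) (j : 'I_(g i)) :
  jordan_cols (P *m X) j = P *m jordan_cols X j.
Proof. by rewrite /jordan_cols !mul_submxrow. Qed.

Lemma jordan_subspace_mulmx P X (i : 'I_k) (j : 'I_(g i)) :
  jordan_subspace (P *m X) j =
  (linfun (mulmx P : 'cV_(jdim r) -> 'cV_(jdim r)) @: jordan_subspace X j)%VS.
Proof. by rewrite /jordan_subspace jordan_cols_mulmx col_span_mulmx. Qed.

Lemma jordan_decomposition_mulmx lambda P C X :
  P \in unitmx -> jordan_decomposition lambda C X ->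
  jordan_decomposition lambda (P *m C *m invmx P) (P *m X).
Proof.
move=> uP [injl g0 r0 uX ->]; split=> //; first by rewrite unitmx_mul uP.
have -> : invmx (P *m X) = invmx X *m invmx P.
  have uPX : P *m X \in unitmx by rewrite unitmx_mul uP.
  (* Left multiplication by the unit [P *m X] is injective, and it sends both candidate inverses to
     the identity. *)
  apply: (can_inj (mulKmx uPX)).
  by rewrite mulmxV // !mulmxA mulmxK // mulmxV.
by rewrite !mulmxA.
Qed.

Lemma class_total_variation_perm_le lambda (s : 'S_(jdim r)) V
    (i : 'I_k) (j : 'I_(g i)) :
  (class_total_variation lambda (jordan_subspace V) j <=
   class_total_variation lambda (jordan_subspace (perm_mx s *m V)) j)%E.
Proof.
(* Inclusion of the sets of values suffices: each value for [V] is attained again after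
   relabelling. *)
apply: le_ereal_sup => _ [C [X [_ dX spanX normX ->]]].
have dPX := jordan_decomposition_mulmx _ _ _ _ (unitmx_perm _ s) dX.
have spanPX (p : 'I_k) (q : 'I_(g p)) :
    jordan_subspace (perm_mx s *m X) q = jordan_subspace (perm_mx s *m V) q
  by rewrite !jordan_subspace_mulmx spanX.
exists (perm_mx s *m C *m invmx (perm_mx s)), (perm_mx s *m X); split=> //.
- by exists (perm_mx s *m X).
- by rewrite jordan_cols_mulmx mx_norm1_perm.
- by rewrite jordan_cols_mulmx total_variation_perm.
Qed.

End Relabelling.

Theorem theorem23 (R : realType) (k : nat) (g : 'I_k -> nat)
    (r : forall i : 'I_k, 'I_(g i) -> nat) (lambda : 'I_k -> R[i])
    (A B T VA VB : 'M[R[i]]_(jdim r))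
    (hA : jordan_decomposition lambda A VA)
    (hT : is_perm_mx T)
    (hBA : B = T *m A *m invmx T)
    (hVB : VB = T *m VA)
    (hB : jordan_decomposition lambda B VB)
    (i : 'I_k) (j : 'I_(g i)) :
  class_total_variation lambda (jordan_subspace VA) j =
  class_total_variation lambda (jordan_subspace VB) j.
Proof.
have /is_perm_mxP [s Ts] := hT.
rewrite hVB Ts; apply/eqP; rewrite eq_le class_total_variation_perm_le /=.
(* Writing [VA] as [P^-1 (P VA)] on the right-hand side only makes the reverse bound an instance of
   the same lemma, for [s^-1] and [P VA]. *)
rewrite -[X in (_ <= class_total_variation _ (jordan_subspace X) _)%O]
  (mulKmx (unitmx_perm R[i] s)).
have -> : invmx (perm_mx s) = perm_mx s^-1 :> 'M[R[i]]_(jdim r).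
  apply: (can_inj (mulKmx (unitmx_perm R[i] s))).
  by rewrite mulmxV ?unitmx_perm // -perm_mxM mulgV perm_mx1.
exact: class_total_variation_perm_le.
Qed.
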